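(* Let $T$ be a countable tree, let $T^+$ be its ramification completion, and let $I$ be the unary predicate on $T^+$ picking out the irrational points $T^+\setminus T$. Then $(T,<)$ is $\aleph_0$-categorical if and only if $(T^+,<,I)$ is $\aleph_0$-categorical.
   Context: A tree is a partial order $(T,\leq)$ such that for all $x,y,z$, if $x,y\leq z$ then $x\leq y$ or $y\leq x$, and for all $x,y$ there is $z$ with $z\leq x,y$. For $x,y$ in a tree, $x\wedge y:=\sup\{t : t\leq x,y\}$, which need not exist in $T$. A tree is ramification complete if it contains $x\wedge y$ for all of its elements $x,y$. The ramification completion $T^+$ of $T$ is the smallest ramification complete tree containing $T$ as a substructure; elements of $T^+\setminus T$ are called irrational. A countable structure is $\aleph_0$-categorical if it is the unique countable model of its first-order theory (equivalently, its automorphism group has finitely many orbits on $n$-tuples for each $n$). *)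

(* Defs.v *)
From HB Require Import structures.
From mathcomp Require Import all_boot all_order.
From mathcomp Require Import boolp classical_sets functions cardinality.

Set Implicit Arguments.
Unset Strict Implicit.
Unset Printing Implicit Defensive.

Import Order.TTheory.

Local Open Scope order_scope.
Local Open Scope classical_set_scope.

(** * First-order logic over relational languages *)

Record signature := Signature { symbol : Type; arity : symbol -> nat }.

Record structure (L : signature) := Structure {
  carrier :> Type;
  interp : forall s : symbol L, ('I_(arity s) -> carrier) -> Prop
}.
Arguments interp {L} _ s _.

(* Formulas with free variables among x_0, ..., x_(n-1); in [Fall phi] the
   quantified variable is x_0 and the old x_k becomes x_(k+1).  Scoping the
   variables lets sentences be evaluated in the empty structure as well. *)
Inductive formula (L : signature) (n : nat) : Type :=
| Fbot : formula L n
| Feq : 'I_n -> 'I_n -> formula L n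
| Frel : forall s : symbol L, ('I_(arity s) -> 'I_n) -> formula L n
| Fimp : formula L n -> formula L n -> formula L n
| Fall : formula L n.+1 -> formula L n.

Definition extend (X : Type) (n : nat) (x : X) (v : 'I_n -> X) : 'I_n.+1 -> X :=
  fun k => if unlift ord0 k is Some k' then v k' else x.

Fixpoint sat (L : signature) (M : structure L) (n : nat) (phi : formula L n)
    : ('I_n -> M) -> Prop :=
  match phi with
  | Fbot => fun _ => False
  | Feq i j => fun v => v i = v j
  | Frel s a => fun v => interp M s (v \o a)
  | Fimp p q => fun v => sat p v -> sat q v
  | Fall p => fun v => forall x : M, sat p (extend x v)
  end.

Definition no_variable (X : Type) (k : 'I_0) : X :=
  False_rect X (notF (ltn_ord k)).

Definition models (L : signature) (M : structure L) (phi : formula L 0) : Prop :=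
  sat phi (@no_variable M).

Definition theory (L : signature) (M : structure L) : set (formula L 0) :=
  [set phi | models M phi].

Definition isomorphic (L : signature) (M N : structure L) : Prop :=
  exists f : M -> N, bijective f /\
    forall (s : symbol L) (v : 'I_(arity s) -> M),
      interp M s v <-> interp N s (f \o v).

(* Countable means finite or countably infinite, so that a finite structure
   counts as categorical; on infinite structures this is the usual notion. *)
Definition aleph0_categorical (L : signature) (M : structure L) : Prop :=
  countable [set: M] /\
  forall N : structure L, countable [set: N] ->
    (forall phi, theory M phi -> models N phi) -> isomorphic M N.

Definition order_signature : signature :=
  @Signature unit (fun _ => 2).

Definition order_structure (d : Order.disp_t) (T : porderType d)
    : structure order_signature :=
  @Structure order_signature T (fun _ v => v ord0 < v ord_max).

Inductive order_pred_symbol := Lt_symbol | Pred_symbol.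

Definition order_pred_signature : signature :=
  @Signature order_pred_symbol (fun s => if s is Lt_symbol then 2 else 1).

Definition order_pred_structure (d : Order.disp_t) (T : porderType d)
    (A : set T) : structure order_pred_signature :=
  @Structure order_pred_signature T
    (fun s => match s return ('I_(@arity order_pred_signature s) -> T) -> Prop with
              | Lt_symbol => fun v => v ord0 < v ord_max
              | Pred_symbol => fun v => A (v ord0)
              end).

(** * Trees *)

Definition is_tree (d : Order.disp_t) (T : porderType d) : Prop :=
  (forall x y z : T, x <= z -> y <= z -> x <= y \/ y <= x) /\
  (forall x y : T, exists z : T, z <= x /\ z <= y).

Definition common_below (d : Order.disp_t) (T : porderType d) (x y : T) : set T :=
  [set t | t <= x /\ t <= y].

(* [is_meet x y] is empty if x /\ y does not exist, and a singleton otherwise. *)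
Definition is_meet (d : Order.disp_t) (T : porderType d) (x y : T) : set T :=
  supremums (common_below x y).

Definition ramification_complete (d : Order.disp_t) (T : porderType d) : Prop :=
  forall x y : T, exists z : T, is_meet x y z.

(* The last clause says that for x, y in T the point x /\ y found in S is the
   supremum of {t in T | t <= x, y}, i.e. the point x /\ y of the Dedekind
   completion of T.  It cannot be dropped: T may also sit in a ramification
   complete tree in which that cut is filled by several different meets, and
   then there is in general no smallest ramification complete extension. *)
Definition ramification_extension (d d' : Order.disp_t)
    (T : porderType d) (S : porderType d') (j : T -> S) : Prop :=
  [/\ is_tree S,
      ramification_complete S,
      {mono j : x y / x <= y} &
      forall x y : T, is_meet (j x) (j y) `<=` supremums (j @` common_below x y)].

Definition ramification_completion (d d' : Order.disp_t)
    (T : porderType d) (P : porderType d') (i : T -> P) : Prop :=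
  ramification_extension i /\
  forall (e : Order.disp_t) (S : porderType e) (j : T -> S),
    ramification_extension j ->
    exists f : P -> S, {mono f : x y / x <= y} /\ forall t : T, f (i t) = j t.

Definition irrational (d d' : Order.disp_t)
    (T : porderType d) (P : porderType d') (i : T -> P) : set P :=
  ~` range i.

(** * Existence of the ramification completion *)

Section Existence.
Context (d : Order.disp_t) (T : porderType d).

Definition is_branching_cut (A : set T) : Prop :=
  exists x y : T, A = common_below x y.

Record branching_cut :=
  BranchingCut { cut_set :> set T; cut_setP : is_branching_cut cut_set }.

HB.instance Definition _ := gen_eqMixin branching_cut.
HB.instance Definition _ := gen_choiceMixin branching_cut.

Lemma cut_set_inj : injective cut_set.
Proof.
move=> [A pA] [B pB] /= e; case: _ / e in pB *.
by rewrite (Prop_irrelevance pA pB).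
Qed.

Definition cut_le (A B : branching_cut) : bool := `[< cut_set A `<=` cut_set B >].

Lemma cut_le_refl : reflexive cut_le.
Proof. by move=> A; apply/asboolP. Qed.

Lemma cut_le_anti : antisymmetric cut_le.
Proof.
by move=> A B /andP[/asboolP AB /asboolP BA]; apply/cut_set_inj/seteqP.
Qed.

Lemma cut_le_trans : transitive cut_le.
Proof.
by move=> B A C /asboolP AB /asboolP BC; apply/asboolP; apply: subset_trans BC.
Qed.

HB.instance Definition _ := Order.Le_isPOrder.Build set_display branching_cut
  cut_le_refl cut_le_anti cut_le_trans.

Definition cut_of (x y : T) : branching_cut :=
  @BranchingCut (common_below x y) (ex_intro _ x (ex_intro _ y erefl)).

Lemma cut_ofE (A : branching_cut) : exists x y, A = cut_of x y.
Proof. by have [x [y e]] := cut_setP A; exists x, y; apply: cut_set_inj. Qed.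

Lemma le_cut (A B : branching_cut) : A <= B <-> cut_set A `<=` cut_set B.
Proof. by split=> /asboolP. Qed.

Hypothesis treeT : is_tree T.

Lemma cut_comparable (x y z : T) :
  common_below x y `<=` common_below x z \/ common_below x z `<=` common_below x y.
Proof.
have [sub|] := pselect (common_below x y `<=` common_below x z); first by left.
move=> /existsNP[a /not_implyP[[ax ay] na]]; right => b [bx bz]; split=> //.
have [ba|ab] := treeT.1 _ _ _ bx ax; first exact: le_trans ba ay.
by case: na; split=> //; apply: le_trans ab bz.
Qed.

Lemma cutI (A B : branching_cut) :
  exists C : branching_cut, cut_set C = cut_set A `&` cut_set B.
Proof.
have [x [y ->]] := cut_ofE A; have [z [w ->]] := cut_ofE B.
have [u uE] : exists u, common_below x u = common_below x z `&` common_below x w.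
  have [/setIidPl e|/setIidPr e] := cut_comparable x z w.
    by exists z; rewrite e.
  by exists w; rewrite e.
have [v vE] : exists v, common_below x v = common_below x y `&` common_below x u.
  have [/setIidPl e|/setIidPr e] := cut_comparable x y u.
    by exists y; rewrite e.
  by exists u; rewrite e.
exists (cut_of x v); rewrite [LHS]vE uE; apply/seteqP; split=> t /=.
  by move=> [[? ?] [[? ?] [? ?]]]; split; split.
by move=> [[? ?] [? ?]]; do !split.
Qed.

Lemma is_meet_cut (A B C : branching_cut) :
  cut_set C = cut_set A `&` cut_set B -> is_meet A B C.
Proof.
move=> e; split=> [D [/le_cut DA /le_cut DB]|D].
  by apply/le_cut; rewrite e subsetI.
by apply; split; apply/le_cut; rewrite e; [apply: subIsetl|apply: subIsetr].
Qed.

Lemma cut_embedding : {mono (fun x : T => cut_of x x) : x y / x <= y}.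
Proof.
move=> x y; apply/idP/idP => [/le_cut sub|xy].
  by have [] : common_below y y x by apply: sub; split.
by apply/le_cut => t [tx _]; split; apply: le_trans tx xy.
Qed.

Lemma ramification_extension_cut :
  ramification_extension (fun x : T => cut_of x x).
Proof.
split.
- split=> [A B C|A B]; last first.
    have [C CE] := cutI A B.
    by exists C; split; apply/le_cut; rewrite CE; [apply: subIsetl|apply: subIsetr].
  have [z [w ->]] := cut_ofE C => /le_cut AC /le_cut BC.
  have [sub|] := pselect (cut_set A `<=` cut_set B); first by left; apply/le_cut.
  move=> /existsNP[a /not_implyP[Aa nBa]]; right; apply/le_cut => b Bb.
  have [az _] := AC _ Aa; have [bz _] := BC _ Bb.
  move: Aa nBa Bb; have [p [q ->]] := cut_ofE A; have [r [s ->]] := cut_ofE B.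
  move=> [ap aq] nBa [br bs].
  have [ab|ba] := treeT.1 _ _ _ az bz.
    by case: nBa; split; [apply: le_trans ab br|apply: le_trans ab bs].
  by split; [apply: le_trans ba ap|apply: le_trans ba aq].
- by move=> A B; have [C CE] := cutI A B; exists C; apply: is_meet_cut.
- exact: cut_embedding.
- move=> x y A mA.
  have -> : A = cut_of x y.
    apply: (is_subset1_supremums mA); apply: is_meet_cut.
    by apply/seteqP; split=> t /=; [move=> [? ?]; split; split|move=> [[? _] [? _]]; split].
  split=> [_ [t [tx ty] <-]|B ubB].
    by apply/le_cut => s [st _]; split; [apply: le_trans st tx|apply: le_trans st ty].
  apply/le_cut => t txy.
  by have /le_cut := ubB _ (imageP _ txy); apply; split.
Qed.

Lemma ramification_completion_exists :
  exists (e : Order.disp_t) (P : porderType e) (i : T -> P),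
    ramification_completion i.
Proof.
exists set_display, branching_cut, (fun x => cut_of x x).
split=> [|e S j [treeS rcS jmono jsup]]; first exact: ramification_extension_cut.
have sup_ex (A : branching_cut) : exists z, supremums (j @` cut_set A) z.
  have [x [y ->]] := cut_ofE A; have [z mz] := rcS (j x) (j y).
  by exists z; apply: jsup.
have [f fP] := choice sup_ex; exists f; split=> [A B|t].
  apply/idP/idP => [fAB|/le_cut AB].
    have [x [y BE]] := cut_ofE B; apply/le_cut => a Aa.
    have jaB : j a <= f B by apply: le_trans fAB; apply: (fP A).1; exists a.
    rewrite BE; split; rewrite -jmono; apply: le_trans jaB _; apply: (fP B).2;
      by rewrite BE => _ [t [tx ty] <-]; rewrite jmono.
  by apply: (fP A).2 => _ [t At <-]; apply: (fP B).1; exists t => //; apply: AB.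
apply: (is_subset1_supremums (fP _)); split=> [_ [s [st _] <-]|z]; first by rewrite jmono.
by apply; exists t.
Qed.

End Existence.

(* Main.v *)
(* Neither side needs to be characterized by types or orbits.  The completion
   is interpreted in the tree: its points are the cuts {t | t <= x, y}, coded by
   pairs (x, y).  Conversely the tree is the relativization of the completion to
   its rational points.  Both constructions respect isomorphism and elementary
   equivalence, and they are mutually inverse on all models of the two theories,
   since a single sentence says that the points of a model are the branching
   cuts of its rational points.  So countable models of the two theories
   correspond, up to isomorphism. *)
Require Import Defs.
From mathcomp Require Import all_boot all_order.
From mathcomp Require Import boolp classical_sets functions cardinality.

Set Implicit Arguments.
Unset Strict Implicit.
Unset Printing Implicit Defensive.

Import Order.TTheory.

Local Open Scope classical_set_scope.

(** * Assignments of variables, pairs, bijections and countability *)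

Lemma extend0 (X : Type) n (x : X) (v : 'I_n -> X) : extend x v ord0 = x.
Proof. by rewrite /extend unlift_none. Qed.

Lemma extendS (X : Type) n (x : X) (v : 'I_n -> X) k :
  extend x v (lift ord0 k) = v k.
Proof. by rewrite /extend liftK. Qed.

Lemma comp_extend (X Y : Type) (f : X -> Y) n (x : X) (v : 'I_n -> X) :
  f \o extend x v = extend (f x) (f \o v).
Proof. by apply/funext => k; rewrite /extend /=; case: (unlift _ _). Qed.

Definition pairv (X : Type) (x y : X) : 'I_2 -> X :=
  fun k => if k == ord0 then x else y.

Lemma pairv_eta (X : Type) (v : 'I_2 -> X) : pairv (v ord0) (v ord_max) = v.
Proof.
apply/funext => k; rewrite /pairv; case: eqP => [->//|k0]; congr v.
by apply/val_inj; move: k k0 => [[|[|m]] km] //= []; apply/val_inj.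
Qed.

Lemma comp_pairv (X Y : Type) (f : X -> Y) x y :
  f \o pairv x y = pairv (f x) (f y).
Proof. by apply/funext => k; rewrite /pairv /=; case: ifP. Qed.

Lemma inj_surj_bijective (X Y : Type) (f : X -> Y) :
  injective f -> (forall y, exists x, f x = y) -> bijective f.
Proof.
move=> fI fS; have [g gK] := choice fS.
by exists g => [x|//]; apply: fI; rewrite gK.
Qed.

Lemma inj_countable (X Y : Type) (f : X -> Y) :
  injective f -> countable [set: Y] -> countable [set: X].
Proof.
move=> fI /countable_injP[g gI]; apply/countable_injP; exists (g \o f).
by move=> x y _ _ /= /gI e; apply: fI; apply: e; apply/in_setT.
Qed.

(** * Elementary equivalence and isomorphism *)

Section Definability.
Context (L : signature).
Implicit Types (M N K : structure L) (n : nat).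

(** [D] is one relation per structure, and a single formula must define it in all structures at
    once. This uniformity is what carries a property between elementarily equivalent structures. *)
Definition definable n (D : forall M, ('I_n -> M) -> Prop) : Prop :=
  exists phi : formula L n, forall M (v : 'I_n -> M), sat phi v <-> D M v.

Lemma definable_ext n (D E : forall M, ('I_n -> M) -> Prop) :
  (forall M v, D M v <-> E M v) -> definable D -> definable E.
Proof. by move=> DE [phi H]; exists phi => M v; rewrite -DE. Qed.

Lemma definable_eq n (i j : 'I_n) : definable (fun M v => v i = v j).
Proof. by exists (Feq L i j). Qed.

Lemma definable_imp n (D E : forall M, ('I_n -> M) -> Prop) :
  definable D -> definable E -> definable (fun M v => D M v -> E M v).
Proof.
move=> [phi HD] [psi HE]; exists (Fimp phi psi) => M v /=.
by rewrite HD HE.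
Qed.

Lemma definable_not n (D : forall M, ('I_n -> M) -> Prop) :
  definable D -> definable (fun M v => ~ D M v).
Proof.
move=> HD; apply: (definable_imp HD (E := fun _ _ => False)).
by exists (Fbot L n).
Qed.

Lemma definable_and n (D E : forall M, ('I_n -> M) -> Prop) :
  definable D -> definable E -> definable (fun M v => D M v /\ E M v).
Proof.
move=> HD HE; have := definable_not (definable_imp HD (definable_not HE)).
apply: definable_ext => M v; split; last by move=> [d e] /(_ d).
by move=> /not_implyP[d /contrapT e].
Qed.

Lemma definable_or n (D E : forall M, ('I_n -> M) -> Prop) :
  definable D -> definable E -> definable (fun M v => D M v \/ E M v).
Proof.
move=> HD HE; have := definable_imp (definable_not HD) HE.
apply: definable_ext => M v; split; last by case.
by have [d|nd] := pselect (D M v); [left | right; auto].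
Qed.

Lemma definable_iff n (D E : forall M, ('I_n -> M) -> Prop) :
  definable D -> definable E -> definable (fun M v => D M v <-> E M v).
Proof. by move=> HD HE; apply: definable_and; apply: definable_imp. Qed.

(** Keeping the quantified point as a separate argument of [D] lets unification read [D] off a goal.
    In the premise that point is variable 0 and the older variables are shifted, as in [Fall]. *)
Lemma definable_all n (D : forall M, ('I_n -> M) -> M -> Prop) :
  definable (fun M (v : 'I_n.+1 -> M) => D M (fun k => v (lift ord0 k)) (v ord0)) ->
  definable (fun M v => forall x, D M v x).
Proof.
move=> [phi H]; exists (Fall phi) => M v /=.
suff E x : sat phi (extend x v) <-> D M v x by split=> F x; apply/E.
rewrite H extend0; suff -> : (fun k => extend x v (lift ord0 k)) = v by [].
by apply/funext => k; rewrite extendS.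
Qed.

Lemma definable_ex n (D : forall M, ('I_n -> M) -> M -> Prop) :
  definable (fun M (v : 'I_n.+1 -> M) => D M (fun k => v (lift ord0 k)) (v ord0)) ->
  definable (fun M v => exists x, D M v x).
Proof.
move=> HD.
have := definable_not (definable_all (D := fun M v x => ~ D M v x) (definable_not HD)).
apply: definable_ext => M v; split; last by move=> [x Dx] /(_ x).
by move=> /existsNP[x /contrapT Dx]; exists x.
Qed.

(** Theories of structures are complete, so this one-sided condition is elementary equivalence; it
    has the form that occurs in [aleph0_categorical]. *)
Definition elem_sub M N : Prop := forall phi, theory M phi -> models N phi.

Lemma elem_sub_definable M N (D : structure L -> Prop) :
  definable (fun M (v : 'I_0 -> M) => D M) -> elem_sub M N -> D M -> D N.
Proof. by move=> [phi H] MN /(H _ (@no_variable M))/MN/H. Qed.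

Lemma isomorphic_sym M N : isomorphic M N -> isomorphic N M.
Proof.
move=> [f [[g fK gK] fE]]; exists g; split; first by exists f.
move=> s v; rewrite fE; suff -> : f \o (g \o v) = v by [].
by apply/funext => k /=; rewrite gK.
Qed.

Lemma isomorphic_trans M N K : isomorphic M N -> isomorphic N K -> isomorphic M K.
Proof.
move=> [f [fb fE]] [g [gb gE]]; exists (g \o f); split; first exact: bij_comp.
by move=> s v; rewrite fE gE.
Qed.

Lemma isomorphic_sat M N (f : M -> N) : bijective f ->
  (forall s (v : 'I_(arity s) -> M), interp M s v <-> interp N s (f \o v)) ->
  forall n (phi : formula L n) (v : 'I_n -> M), sat phi v <-> sat phi (f \o v).
Proof.
move=> fb fE n phi; elim: n / phi => //=.
- by move=> n i j v; split=> [->//|/(bij_inj fb)].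
- by move=> n p IHp q IHq v; rewrite IHp IHq.
move=> n p IHp v; case: fb => g fK gK; split=> H x.
  by have /IHp := H (g x); rewrite comp_extend gK.
by apply/IHp; rewrite comp_extend.
Qed.

Lemma no_variable_unique (X : Type) (v : 'I_0 -> X) : v = @no_variable X.
Proof. by apply/funext => -[]. Qed.

Lemma isomorphic_elem_sub M N : isomorphic M N -> elem_sub M N.
Proof.
move=> [f [fb fE]] phi /(isomorphic_sat fb fE).
by rewrite (no_variable_unique (f \o _)).
Qed.

Lemma elem_sub_trans M N K : elem_sub M N -> elem_sub N K -> elem_sub M K.
Proof. by move=> MN NK phi /MN/NK. Qed.

Lemma isomorphic_countable M N :
  isomorphic M N -> countable [set: N] -> countable [set: M].
Proof. by move=> [f [/bij_inj fI _]]; apply: inj_countable fI. Qed.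

Lemma isomorphic_aleph0_categorical M N :
  isomorphic M N -> aleph0_categorical M -> aleph0_categorical N.
Proof.
move=> MN [cM catM]; have NM := isomorphic_sym MN.
split=> [|K cK NK]; first exact: isomorphic_countable NM cM.
apply: isomorphic_trans NM _; apply: catM => //.
exact: elem_sub_trans (isomorphic_elem_sub MN) NK.
Qed.

End Definability.

(** * The structure of branching cuts and its rational part *)

Definition lt (M : structure order_signature) (x y : M) : Prop :=
  interp M tt (pairv x y).

Definition ltp (Q : structure order_pred_signature) (x y : Q) : Prop :=
  @interp order_pred_signature Q Lt_symbol (pairv x y).

Definition irr (Q : structure order_pred_signature) (x : Q) : Prop :=
  @interp order_pred_signature Q Pred_symbol (fun _ => x).

Definition rle (X : Type) (R : X -> X -> Prop) (x y : X) : Prop := R x y \/ x = y.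

Lemma order_isomorphic (M N : structure order_signature) (f : M -> N) :
  bijective f -> (forall x y, lt x y <-> lt (f x) (f y)) -> isomorphic M N.
Proof.
move=> fb fE; exists f; split=> // -[] v; rewrite -[v]pairv_eta comp_pairv.
exact: fE.
Qed.

Lemma order_pred_isomorphic (M N : structure order_pred_signature) (f : M -> N) :
  bijective f -> (forall x y, ltp x y <-> ltp (f x) (f y)) ->
  (forall x, irr x <-> irr (f x)) -> isomorphic M N.
Proof.
move=> fb flt firr; exists f; split=> // -[] v.
  by rewrite -[v]pairv_eta comp_pairv; apply: flt.
have -> : v = fun=> v ord0 by apply/funext => k; rewrite ord1.
exact: firr.
Qed.

Lemma isomorphic_lt (M N : structure order_signature) :
  isomorphic M N -> exists2 f : M -> N,
    bijective f & forall x y, lt x y <-> lt (f x) (f y).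
Proof. by move=> [f [fb fE]]; exists f => // x y; rewrite /lt fE comp_pairv. Qed.

Lemma isomorphic_ltp (M N : structure order_pred_signature) :
  isomorphic M N -> exists f : M -> N,
    [/\ bijective f, forall x y, ltp x y <-> ltp (f x) (f y) &
      forall x, irr x <-> irr (f x)].
Proof.
move=> [f [fb fE]]; exists f; split=> // [x y|x]; last exact: fE.
by rewrite /ltp fE comp_pairv.
Qed.

Lemma rle_bij (X Y : Type) (R : X -> X -> Prop) (S : Y -> Y -> Prop) (f : X -> Y) :
  injective f -> (forall x y, R x y <-> S (f x) (f y)) ->
  forall x y, rle R x y <-> rle S (f x) (f y).
Proof.
move=> fI fE x y; split=> [[/fE ?|->]|[/fE ?|/fI ->]]; by [left|right].
Qed.

Lemma definable_lt n (i j : 'I_n) : definable (fun M v => @lt M (v i) (v j)).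
Proof.
by exists (@Frel order_signature n tt (pairv i j)) => M v /=; rewrite comp_pairv.
Qed.

Lemma definable_ltp n (i j : 'I_n) : definable (fun Q v => @ltp Q (v i) (v j)).
Proof.
exists (@Frel order_pred_signature n Lt_symbol (pairv i j)) => M v /=.
by rewrite comp_pairv.
Qed.

Lemma definable_irr n (i : 'I_n) : definable (fun Q v => @irr Q (v i)).
Proof. by exists (@Frel order_pred_signature n Pred_symbol (fun=> i)). Qed.

(** A negation is an implication into [False], for which no rule is listed, so [definable_not] comes
    before [definable_imp]. *)
Ltac definability := repeat first
  [ exact: definable_lt | exact: definable_ltp | exact: definable_irr
  | exact: definable_eq | apply: definable_not | apply: definable_iff
  | apply: definable_and | apply: definable_or
  | apply: definable_all; cbv beta | apply: definable_ex; cbv beta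
  | apply: definable_imp ].

Section Cuts.
Implicit Types (M N : structure order_signature)
  (Q : structure order_pred_signature).

Definition cut M (x y : M) : set M := [set t | rle (@lt M) t x /\ rle (@lt M) t y].

(** A point is the cut itself and not a code [(x, y)], so that two codes of the same cut give equal
    points without forming a quotient. *)
Definition cuts M : Type := {A : set M | exists x y, A = cut x y}.

Definition mkcut M (x y : M) : cuts M :=
  exist _ (cut x y) (ex_intro _ x (ex_intro _ y erefl)).

Definition cut_structure M : structure order_pred_signature :=
  @Structure order_pred_signature (cuts M)
    (fun s => match s return ('I_(@arity order_pred_signature s) -> cuts M) -> Prop with
              | Lt_symbol => fun v => sval (v ord0) `<` sval (v ord_max)
              | Pred_symbol => fun v => ~ exists x, sval (v ord0) = cut x x
              end).

Definition rational_part Q : structure order_signature :=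
  @Structure order_signature {x : Q | ~ irr x}
    (fun _ v => @interp order_pred_signature Q Lt_symbol (fun k => sval (v k))).

Lemma lt_rational Q (x y : rational_part Q) : lt x y <-> ltp (sval x) (sval y).
Proof. by rewrite /ltp -comp_pairv. Qed.

Lemma sval_inj (X : Type) (D : X -> Prop) : injective (@proj1_sig X D).
Proof. by move=> [x Dx] [y Dy] /= e; apply: eq_exist. Qed.

Lemma rle_rational Q (x y : rational_part Q) :
  rle (@lt _) x y <-> rle (@ltp Q) (sval x) (sval y).
Proof. exact: rle_bij (@sval_inj _ _) (@lt_rational Q) x y. Qed.

Lemma cut_structure_surj M (A : cut_structure M) : exists x y, A = mkcut x y.
Proof.
by case: A => A [x [y e]]; exists x, y; apply: eq_exist.
Qed.

Lemma countable_cut_structure M :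
  countable [set: M] -> countable [set: cut_structure M].
Proof.
move=> cM.
have PF (A : cut_structure M) : exists xy, A = mkcut xy.1 xy.2.
  by have [x [y ->]] := cut_structure_surj A; exists (x, y).
have [f fE] := choice PF.
apply: (@inj_countable _ (M * M)%type f).
  by move=> A B e; rewrite (fE A) e -fE.
by rewrite -setXTT; apply: countableX.
Qed.

Lemma countable_rational_part Q :
  countable [set: Q] -> countable [set: rational_part Q].
Proof. exact: inj_countable (@sval_inj _ _). Qed.

(* The variable x_k, ranging over cuts, becomes the pair x_(a k), x_(b k). *)
Lemma cut_structure_definable n (phi : formula order_pred_signature n) m
    (a b : 'I_n -> 'I_m) :
  definable (fun M v =>
    @sat _ (cut_structure M) n phi (fun k => mkcut (v (a k)) (v (b k)))).
Proof.
elim: n / phi m a b => /= [n|n i j|n [] c|n p IHp q IHq|n p IHp] m a b.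
- by exists (Fbot _ _).
(* Equality of coded points is equality of sets, hence a universal statement about elements of
   [M]. *)
- apply: (definable_ext (D := fun M v => forall t : M,
    cut (v (a i)) (v (b i)) t <-> cut (v (a j)) (v (b j)) t)).
    move=> M v; split=> [e|[e] t]; last by rewrite e.
    by apply: eq_exist; apply/seteqP; split=> t /e.
  by rewrite /cut /rle /=; definability.
- by rewrite /proper /subset /cut /rle /=; definability.
- apply: (definable_ext (D := fun M v => ~ exists x, forall t : M,
    cut (v (a (c ord0))) (v (b (c ord0))) t <-> cut x x t)).
    move=> M v; split; apply: contra_not => -[x /= e]; exists x; first by move=> t; rewrite e.
    by apply/seteqP; split=> t /e.
  by rewrite /cut /rle /=; definability.
- by apply: definable_imp.
(* A quantifier over cuts becomes two quantifiers over [M]. The new cut is coded by variable 1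
   (bound by the outer quantifier) and variable 0 (bound by the inner one), and [s] shifts the older
   variables past both. *)
pose s (k : 'I_m) : 'I_m.+2 := lift ord0 (lift ord0 k).
have := IHp m.+2 (extend (lift ord0 ord0) (s \o a)) (extend ord0 (s \o b)).
have E M (v : 'I_m.+2 -> M) :
    (fun k => mkcut (v (extend (lift ord0 ord0) (s \o a) k))
                    (v (extend ord0 (s \o b) k))) =
    extend (mkcut (v (lift ord0 ord0)) (v ord0))
      (fun k => mkcut (v (s (a k))) (v (s (b k)))).
  by apply/funext => k; rewrite /extend /=; case: (unlift _ _).
move=> H; apply: (definable_ext (D := fun M v => forall x y : M,
    @sat _ (cut_structure M) _ p
      (extend (mkcut x y) (fun k => mkcut (v (a k)) (v (b k)))))).
  move=> M v; split=> [F A|F x y]; last exact: F.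
  by have [x [y ->]] := cut_structure_surj A; apply: F.
do 2 apply: definable_all; cbv beta.
by apply: definable_ext H => M v; rewrite E.
Qed.

Lemma elem_sub_cut_structure M N :
  elem_sub M N -> elem_sub (cut_structure M) (cut_structure N).
Proof.
move=> MN phi; rewrite /theory /models /=.
have [psi H] := cut_structure_definable phi (@no_variable 'I_0) (@no_variable 'I_0).
have {}H (K : structure order_signature) :
    sat psi (@no_variable K) <-> sat phi (@no_variable (cut_structure K)).
  by rewrite H (no_variable_unique (fun k => mkcut _ _)).
by move=> /H/MN/H.
Qed.

(** Every quantifier is guarded by the negated predicate. The formula obtained depends on [phi]
    alone and serves all [Q], which is what comparing theories requires. *)
Lemma rational_part_relativization n (phi : formula order_signature n) :
  exists psi : formula order_pred_signature n, forall Q (r : 'I_n -> rational_part Q),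
    sat psi (fun k => sval (r k)) <-> sat phi r.
Proof.
elim: n / phi => /= [n|n i j|n s c|n p [p' IHp] q [q' IHq]|n p [p' IHp]].
- by exists (Fbot _ _).
- by exists (Feq _ i j) => Q r /=; split=> [/sval_inj|->].
- case: s c => c; exists (@Frel order_pred_signature n Lt_symbol c) => Q r /=.
  by [].
- by exists (Fimp p' q') => Q r /=; rewrite IHp IHq.
exists (Fall (Fimp (Fimp (@Frel order_pred_signature _ Pred_symbol (fun=> ord0))
  (Fbot _ _)) p')) => Q r /=.
have E (x : rational_part Q) :
    (fun k => sval (extend x r k)) = extend (sval x) (fun k => sval (r k)).
  by rewrite -[RHS]comp_extend.
have I (x : Q) : extend x (fun k => sval (r k)) \o (fun=> ord0) = (fun=> x) :> ('I_1 -> Q).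
  by apply/funext => k /=; rewrite extend0.
split=> [F x|F x Ix].
  by apply/IHp; rewrite E; apply: F; rewrite I; apply: (svalP x).
have nx : ~ irr x by rewrite /irr -I.
by have /IHp := F (exist _ x nx); rewrite E.
Qed.

Lemma elem_sub_rational_part Q Q' :
  elem_sub Q Q' -> elem_sub (rational_part Q) (rational_part Q').
Proof.
move=> QQ phi; have [psi H] := rational_part_relativization phi.
have {}H (K : structure order_pred_signature) :
    sat psi (@no_variable K) <-> sat phi (@no_variable (rational_part K)).
  by rewrite -H (no_variable_unique (fun k => sval _)).
by move=> /H/QQ/H.
Qed.

(** * Invariance of both constructions under isomorphism *)

Lemma isomorphic_cut_structure M N :
  isomorphic M N -> isomorphic (cut_structure M) (cut_structure N).
Proof.
move=> /isomorphic_lt[f fb flt]; have fle := rle_bij (bij_inj fb) flt.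
have [g fK gK] := fb.
have fcut x y t : cut (f x) (f y) t <-> cut x y (g t).
  by rewrite /cut /= !fle gK.
have PF (A : cuts M) : exists x y, [set t | sval A (g t)] = cut (f x) (f y).
  have [x [y ->]] := cut_structure_surj A; exists x, y.
  by apply/seteqP; split=> t /fcut.
(* [F] takes the image of a cut under [f], written as the preimage under the inverse [g]; the proof
   component turns codes [x], [y] into [f x], [f y]. *)
pose F (A : cut_structure M) : cut_structure N :=
  exist _ [set t | sval A (g t)]
    (let: ex_intro x (ex_intro y e) := PF A in
     ex_intro _ (f x) (ex_intro _ (f y) e)).
have FE A t : sval (F A) (f t) <-> sval A t by rewrite /= fK.
have Fsub A B : sval (F A) `<=` sval (F B) <-> sval A `<=` sval B.
  by split=> AB t => [/FE/AB/FE|/AB].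
apply: (@order_pred_isomorphic (cut_structure M) (cut_structure N) F).
- apply: inj_surj_bijective => [A B e|B].
    by apply/sval_inj/seteqP; split; apply/Fsub; rewrite e.
  have [x [y ->]] := cut_structure_surj B; exists (mkcut (g x) (g y)).
  by apply/sval_inj/seteqP; split=> t /=; rewrite -fcut !gK.
- by move=> A B; rewrite /ltp /= /proper; split=> -[? ?]; split; rewrite ?Fsub // -?Fsub.
move=> A; split; apply: contra_not => -[x e].
  exists (g x); apply/seteqP; split=> t.
    by move=> /FE; rewrite e -[x]gK => /fcut; rewrite !gK fK.
  by move=> H; apply/FE; rewrite e -[x]gK; apply/fcut; rewrite fK.
exists (f x); apply/seteqP; split=> t /=.
  by move: e; rewrite /= => -> H; apply/fcut.
by move: e; rewrite /= => -> /fcut.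
Qed.

Lemma isomorphic_rational_part Q Q' :
  isomorphic Q Q' -> isomorphic (rational_part Q) (rational_part Q').
Proof.
move=> /isomorphic_ltp[f [fb flt firr]].
have nF (x : rational_part Q) : ~ irr (f (sval x)) by move/firr; apply: (svalP x).
pose F (x : rational_part Q) : rational_part Q' := exist _ (f (sval x)) (nF x).
apply: (@order_isomorphic (rational_part Q) (rational_part Q') F).
  have [g fK gK] := fb; apply: inj_surj_bijective => [x y [/(bij_inj fb)/sval_inj]//|[y ny]].
  have nx : ~ irr (g y) by rewrite firr gK.
  by exists (exist _ (g y) nx); apply: sval_inj => /=.
by move=> x y; rewrite !lt_rational flt.
Qed.

(** * Recovering an order from its cuts *)

Definition is_order M : Prop :=
  (forall x : M, ~ lt x x) /\ (forall x y z : M, lt x y -> lt y z -> lt x z).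

Lemma is_order_definable : definable (fun M (v : 'I_0 -> M) => is_order M).
Proof. by rewrite /is_order; definability. Qed.

Section Order.
Context (M : structure order_signature).
Hypothesis ordM : is_order M.

Lemma rle_lt_trans (x y z : M) : rle (@lt M) x y -> rle (@lt M) y z -> rle (@lt M) x z.
Proof.
move=> [xy|->//] [yz|<-]; last by left.
by left; apply: ordM.2 yz.
Qed.

Lemma rle_lt_anti (x y : M) : rle (@lt M) x y -> rle (@lt M) y x -> x = y.
Proof.
by move=> [xy|//] [yx|//]; case: (ordM.1 x); apply: ordM.2 yx.
Qed.

(** Cuts are downward closed, and [x] is the largest element of [cut x x]. *)
Lemma sub_cut (A : cut_structure M) x : cut x x `<=` sval A <-> sval A x.
Proof.
split=> [sub|Ax t [tx _]]; first by apply: sub; split; right.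
move: Ax; have [y [z ->]] := cut_structure_surj A => -[xy xz].
by split; apply: rle_lt_trans tx _.
Qed.

Lemma sub_cut_cut (x y : M) : cut x x `<=` cut y y <-> rle (@lt M) x y.
Proof. by rewrite (sub_cut (mkcut y y)); split=> [[]|]. Qed.

Lemma proper_cut (x y : M) : cut x x `<` cut y y <-> lt x y.
Proof.
split=> [[/sub_cut_cut [//|->] []//]|xy].
split; first by apply/sub_cut_cut; left.
move=> /sub_cut_cut yx; apply: (ordM.1 x).
by rewrite {2}(rle_lt_anti (or_introl xy) yx).
Qed.

(** The rational points of the cut structure are by definition the principal cuts, and sending [x]
    to [cut x x] preserves and reflects the order. *)
Lemma isomorphic_rational_cut : isomorphic M (rational_part (cut_structure M)).
Proof.
have nI x : ~ @irr (cut_structure M) (mkcut x x) by move=> /(_ (ex_intro _ x erefl)).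
pose f x : rational_part (cut_structure M) := exist _ (mkcut x x) (nI x).
apply: (order_isomorphic (f := f)); last first.
  by move=> x y; rewrite lt_rational -proper_cut.
apply: inj_surj_bijective => [x y [e]|[A nA]].
  by apply: rle_lt_anti; apply/sub_cut_cut; rewrite e.
have [x e] := contrapT nA.
by exists x; apply/sval_inj/sval_inj; rewrite /= -e.
Qed.

End Order.

(** * A sentence characterizing structures of cuts *)

Definition rsub Q (p q : Q) : Prop :=
  forall t : Q, ~ irr t -> rle (@ltp Q) t p -> rle (@ltp Q) t q.

(** Call the set of rational points below [p] its trace. Here the trace of [p] is the cut of [x] and
    [y], so [p] is the point coded by the pair; [rsub] is inclusion of traces. *)
Definition rglb Q (x y p : Q) : Prop := forall t : Q, ~ irr t ->
  (rle (@ltp Q) t p <-> rle (@ltp Q) t x /\ rle (@ltp Q) t y).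

(** In turn: a point is determined by its trace, the order is strict inclusion of traces, every
    trace is a branching cut of the rational points, and every such cut is a trace. *)
Definition cut_like Q : Prop :=
  [/\ forall p q : Q, rsub p q -> rsub q p -> p = q,
      forall p q : Q, ltp p q <-> rsub p q /\ ~ rsub q p,
      forall p : Q, exists x y, (~ irr x /\ ~ irr y) /\ rglb x y p &
      forall x y : Q, ~ irr x -> ~ irr y -> exists p, rglb x y p].

Lemma cut_like_definable : definable (fun Q (v : 'I_0 -> Q) => cut_like Q).
Proof.
(* The fourfold conjunction is a connective of its own, so it is first unfolded into binary ones, to
   which [definable_and] applies. *)
apply: (definable_ext (D := fun Q (v : 'I_0 -> Q) =>
  (forall p q : Q, rsub p q -> rsub q p -> p = q) /\
  ((forall p q : Q, ltp p q <-> rsub p q /\ ~ rsub q p) /\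
  ((forall p : Q, exists x y, (~ irr x /\ ~ irr y) /\ rglb x y p) /\
  (forall x y : Q, ~ irr x -> ~ irr y -> exists p, rglb x y p))))).
  by move=> Q _; split=> [[? [? []]]|[]].
by rewrite /rsub /rglb /rle; definability.
Qed.

(** The rational points below a cut [A] are the principal cuts of the elements of [A]. Hence
    inclusion of traces is inclusion of cuts, and each clause becomes a fact about sets. *)
Lemma cut_like_cut_structure M : is_order M -> cut_like (cut_structure M).
Proof.
move=> ordM; set Q := cut_structure M.
have rleE (A B : Q) : rle (@ltp Q) A B <-> sval A `<=` sval B.
  split=> [[[]//|->]//|AB]; have [BA|nBA] := pselect (sval B `<=` sval A).
    by right; apply/sval_inj/seteqP.
  by left.
have rat x : ~ @irr Q (mkcut x x) by move=> /(_ (ex_intro _ x erefl)).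
have ratP (A : Q) : ~ irr A -> exists x, A = mkcut x x.
  by move=> /contrapT[x e]; exists x; apply: sval_inj.
have rsubE (A B : Q) : rsub A B <-> sval A `<=` sval B.
  split=> [AB x Ax|AB t _ /rleE tA]; last by apply/rleE; apply: subset_trans AB.
  apply/(sub_cut ordM)/(rleE (mkcut x x)); apply: AB => //.
  exact/rleE/(sub_cut ordM).
have glb (x y : M) : @rglb Q (mkcut x x) (mkcut y y) (mkcut x y).
  move=> _ /ratP[t ->]; rewrite !rleE /= !(sub_cut_cut ordM).
  exact: (sub_cut ordM (mkcut x y)).
split.
- by move=> A B /rsubE AB /rsubE BA; apply/sval_inj/seteqP.
- by move=> A B; rewrite !rsubE.
- move=> A; have [x [y ->]] := cut_structure_surj A.
  by exists (mkcut x x), (mkcut y y); split.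
- by move=> _ _ /ratP[x ->] /ratP[y ->]; exists (mkcut x y).
Qed.

(** The isomorphism sends a point to its trace. The third clause of [cut_like] makes the trace a
    cut, the first gives injectivity, the fourth surjectivity and the second the order. *)
Lemma isomorphic_cut_rational Q :
  cut_like Q -> isomorphic Q (cut_structure (rational_part Q)).
Proof.
move=> [anti ltE surj total].
pose below (p : Q) : set (rational_part Q) := [set t | rle (@ltp Q) (sval t) p].
have belowE (x y : rational_part Q) p : rglb (sval x) (sval y) p -> below p = cut x y.
  move=> g; apply/seteqP; split=> t; rewrite /cut /= !rle_rational.
    by move/(g _ (svalP t)).
  by move=> ?; apply/(g _ (svalP t)).
have PF p : exists x y, below p = cut x y.
  have [x [y [[nx ny] g]]] := surj p.
  by exists (exist _ x nx), (exist _ y ny); apply: belowE.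
pose F p : cut_structure (rational_part Q) := exist _ (below p) (PF p).
have Fsub p q : below p `<=` below q <-> rsub p q.
  by split=> [pq t nt|pq t /(pq _ (svalP t))//]; apply: (pq (exist _ t nt)).
have FI : injective F by move=> p q [e]; apply: anti; apply/Fsub; rewrite e.
apply: (order_pred_isomorphic (f := F)).
- apply: inj_surj_bijective => // A; have [x [y ->]] := cut_structure_surj A.
  have [p g] := total _ _ (svalP x) (svalP y); exists p.
  by apply: sval_inj; apply: belowE.
- by move=> p q; rewrite ltE -!Fsub.
(* A point whose trace is [cut x x] has the same trace as the rational point [x], hence equals it;
   conversely the trace of a rational [p] is the principal cut of [p]. *)
move=> p; split=> [Ip [x /= e]|nI].
  apply: (svalP x); suff -> : sval x = p by [].
  by apply: anti; apply/Fsub; rewrite e => t; rewrite /cut /= rle_rational; tauto.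
apply: contrapT => np; apply: nI; exists (exist _ p np).
by rewrite -(@belowE _ _ p) // => t nt; split=> [|[]].
Qed.

(** * Transfer of categoricity between an order and its cuts *)

Lemma aleph0_categorical_cut_structure M :
  is_order M -> countable [set: M] ->
  aleph0_categorical M <-> aleph0_categorical (cut_structure M).
Proof.
move=> ordM cM; split=> [[_ catM]|[_ catC]].
  split=> [|Q cQ MQ]; first exact: countable_cut_structure.
  (* [M] is the rational part of its cut structure, so relativization makes the rational part of [Q]
     a countable model of the theory of [M]. *)
  have MR : isomorphic M (rational_part Q).
    apply: catM; first exact: countable_rational_part.
    apply: elem_sub_trans (isomorphic_elem_sub (isomorphic_rational_cut ordM)) _.
    exact: elem_sub_rational_part.
  (* The sentence [cut_like] passes from [cut_structure M] to [Q], so [Q] is the cut structure of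
     its own rational part. *)
  apply: isomorphic_trans (isomorphic_cut_structure MR) _.
  apply/isomorphic_sym/isomorphic_cut_rational.
  exact: elem_sub_definable cut_like_definable MQ (cut_like_cut_structure ordM).
split=> // N cN MN.
(* Being a strict order is a single sentence, so [N] too is the rational part of its cut structure;
   it remains to compare the two cut structures. *)
have ordN : is_order N := elem_sub_definable is_order_definable MN ordM.
apply: isomorphic_trans (isomorphic_rational_cut ordM) _.
apply: isomorphic_trans (isomorphic_sym (isomorphic_rational_cut ordN)).
apply: isomorphic_rational_part; apply: catC; first exact: countable_cut_structure.
exact: elem_sub_cut_structure.
Qed.

End Cuts.

(** * The completion as the structure of branching cuts *)

Section Completion.
Context (d d' : Order.disp_t) (T : porderType d) (P : porderType d').

Lemma lt_order_structure (x y : order_structure T) : lt x y <-> (x < y :> T)%O.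
Proof. by []. Qed.

Lemma is_order_order_structure : is_order (order_structure T).
Proof.
split=> [x|x y z]; rewrite !lt_order_structure ?ltxx //; exact: lt_trans.
Qed.

Lemma rle_order_structure (x y : T) :
  rle (@lt (order_structure T)) x y <-> (x <= y)%O.
Proof.
split=> [[/ltW//|->//]|]; rewrite le_eqVlt => /orP[/eqP->|]; by [right|left].
Qed.

Lemma cut_order_structure (x y : T) :
  @cut (order_structure T) x y = common_below x y.
Proof. by apply/seteqP; split=> t [/rle_order_structure ? /rle_order_structure ?]. Qed.

(* By minimality the completion embeds in the tree of branching cuts; the
   embedding is onto because meets of points of T are prescribed. *)
Lemma completion_isomorphic_cut_structure (i : T -> P) :
  is_tree T -> ramification_completion i ->
  isomorphic (order_pred_structure (irrational i)) (cut_structure (order_structure T)).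
Proof.
move=> treeT [[_ rcP imono imeet] min].
have [f [fmono fi]] := min _ _ _ (ramification_extension_cut treeT).
have fI : injective f := inc_inj fmono.
have PF p : exists x y : order_structure T, cut_set (f p) = cut x y.
  by have [x [y ->]] := cut_ofE (f p); exists x, y; rewrite cut_order_structure.
pose F (p : order_pred_structure (irrational i)) : cut_structure (order_structure T) :=
  exist _ (cut_set (f p)) (PF p).
have FE (p q : P) : (p < q)%O <-> cut_set (f p) `<` cut_set (f q).
  rewrite lt_leAnge -!fmono; split=> [/andP[/le_cut ? /negP n]|[pq n]].
    by split=> // s; apply/n/le_cut.
  by apply/andP; split; [apply/le_cut|apply/negP => /le_cut].
apply: (order_pred_isomorphic (f := F)).
- apply: inj_surj_bijective => [p q /(congr1 sval)/cut_set_inj/fI//|A].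
  have [x [y ->]] := cut_structure_surj A.
  have [z mz] := rcP (i x) (i y); exists z; apply: sval_inj.
  (* The cut of [z] lies in that of [x] and [y] because [z] is below [i x] and [i y]. For the
     converse, [imeet] makes [z] an upper bound of the images of all points of [T] below [x] and
     [y]. *)
  rewrite /= cut_order_structure; apply/seteqP; split=> t zt.
    have zx : (z <= i x)%O by apply: mz.2 => u [].
    have zy : (z <= i y)%O by apply: mz.2 => u [].
    by move: zx zy; rewrite -!fmono !fi => /le_cut/(_ _ zt)[tx _] /le_cut/(_ _ zt)[].
  have : (i t <= z)%O by apply: (imeet _ _ _ mz).1; exists t.
  by rewrite -fmono fi => /le_cut; apply.
- exact: FE.
(* [f] maps [i x] to the principal cut of [x] and is injective, so the range of [i] corresponds
   exactly to the principal cuts. *)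
move=> p; split; apply: contra_not.
  move=> [x /= e]; exists x => //; apply/fI/cut_set_inj.
  by rewrite fi e cut_order_structure.
by move=> [x _ <-]; exists x; rewrite /= fi cut_order_structure.
Qed.

End Completion.

Theorem theorem3p5 (d d' : Order.disp_t) (T : porderType d) (P : porderType d')
    (i : T -> P) :
  is_tree T -> countable [set: T] -> ramification_completion i ->
  aleph0_categorical (order_structure T) <->
  aleph0_categorical (order_pred_structure (irrational i)).
Proof.
move=> treeT cT Pi.
have iso := completion_isomorphic_cut_structure treeT Pi.
rewrite (aleph0_categorical_cut_structure (@is_order_order_structure _ T)) //.
by split; apply: isomorphic_aleph0_categorical => //; apply: isomorphic_sym.
Qed.
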